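(* Let $p\ge 1$ and let $\Gamma:\Omega\to\mathcal{K}_c(\mathbb{R}^p)$ be a compact convex random set on a probability space $(\Omega,\mathcal{A},\mathbb{P})$. Then for every non-singular matrix $M\in\mathcal{M}_{p\times p}(\mathbb{R})$ and all $K,L\in\mathcal{K}_c(\mathbb{R}^p)$, $$D_{CT}(M\cdot K+L;\,M\cdot\Gamma+L)=D_{CT}(K;\Gamma).$$
   Context: $\mathcal{K}_c(\mathbb{R}^p)$ denotes the set of non-empty compact convex subsets of $\mathbb{R}^p$, and $\mathbb{S}^{p-1}=\{x\in\mathbb{R}^p:\|x\|=1\}$ the Euclidean unit sphere. The support function of $K\in\mathcal{K}_c(\mathbb{R}^p)$ is $s_K:\mathbb{S}^{p-1}\to\mathbb{R}$, $s_K(u)=\sup_{k\in K}\langle k,u\rangle$. For $K,L\in\mathcal{K}_c(\mathbb{R}^p)$ and a real $p\times p$ matrix $M$, $K+L=\{k+l:k\in K,l\in L\}$ and $M\cdot K=\{M\cdot k:k\in K\}$; $\mathcal{M}_{p\times p}(\mathbb{R})$ is the space of real $p\times p$ matrices. A map $\Gamma:\Omega\to\mathcal{K}_c(\mathbb{R}^p)$ on a probability space $(\Omega,\mathcal{A},\mathbb{P})$ is a compact convex random set if $\{\omega\in\Omega:\Gamma(\omega)\cap K\ne\emptyset\}\in\mathcal{A}$ for all $K\in\mathcal{K}_c(\mathbb{R}^p)$; equivalently, it is Borel measurable with respect to the Hausdorff metric. The set $M\cdot\Gamma+L$ is the random set $\omega\mapsto M\cdot\Gamma(\omega)+L$. For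 $u\in\mathbb{S}^{p-1}$, $t\in\mathbb{R}$, define the halfspaces $S^-_{u,t}=\{K\in\mathcal{K}_c(\mathbb{R}^p):s_K(u)\le t\}$ and $S^+_{u,t}=\{K\in\mathcal{K}_c(\mathbb{R}^p):s_K(u)\ge t\}$. The Tukey depth of $K\in\mathcal{K}_c(\mathbb{R}^p)$ with respect to $\Gamma$ is $$D_{CT}(K;\Gamma)=\min\Big\{\inf_{u\in\mathbb{S}^{p-1},\,t\in\mathbb{R}:\ K\in S^-_{u,t}}\mathbb{P}(\Gamma\in S^-_{u,t}),\ \inf_{u\in\mathbb{S}^{p-1},\,t\in\mathbb{R}:\ K\in S^+_{u,t}}\mathbb{P}(\Gamma\in S^+_{u,t})\Big\}.$$ *)

(* Defs.v *)
From HB Require Import structures.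
From mathcomp Require Import all_boot all_order all_algebra.
From mathcomp Require Import all_classical all_reals all_analysis.
Import Order.TTheory GRing.Theory Num.Theory.
Import numFieldNormedType.Exports.

Set Implicit Arguments.
Unset Strict Implicit.
Unset Printing Implicit Defensive.

Local Open Scope classical_set_scope.
Local Open Scope ring_scope.

(* Column vectors carry the entrywise (product) topology, which is the usual
   topology of R^p; their library norm is the max norm, hence the explicit
   Euclidean inner product and norm below. *)
Definition dot (R : realType) (p : nat) (x y : 'cV[R]_p) : R :=
  \sum_(i < p) x i 0 * y i 0.

Definition unit_sphere (R : realType) (p : nat) : set 'cV[R]_p :=
  [set u | Num.sqrt (dot u u) = 1].

Record convex_body (R : realType) (p : nat) := ConvexBody {
  body :> set 'cV[R]_p ;
  body_nonempty : body !=set0 ;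
  body_compact : compact body ;
  body_convex : convex_set (body : set (convex_lmodType 'cV[R]_p)) }.

(* The supremum of a nonempty bounded set of reals, since K is a convex body. *)
Definition support_function (R : realType) (p : nat) (K : convex_body R p)
  (u : 'cV[R]_p) : R := sup [set dot k u | k in (K : set 'cV[R]_p)].

Definition minkowski_sum (R : realType) (p : nat) (K L : set 'cV[R]_p) :
  set 'cV[R]_p := [set k + l | k in K & l in L].

Definition matrix_image (R : realType) (p : nat) (M : 'M[R]_p)
  (K : set 'cV[R]_p) : set 'cV[R]_p := [set M *m k | k in K].

Section closure_properties.
Variables (R : realType) (p : nat).
Implicit Types (K L : convex_body R p) (M : 'M[R]_p).

Lemma continuous_mulmx_col M : continuous (fun x : 'cV[R]_p => M *m x).
Proof.
have -> : (fun x : 'cV[R]_p => M *m x) =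
    (fun x : 'cV[R]_p => \sum_j x j 0 *: col j M).
  apply/funext => x; apply/colP => i; rewrite mxE summxE.
  by apply: eq_bigr => j _; rewrite !mxE mulrC.
apply: (@continuous_big 'cV[R]_p 'I_p) => [|j _ x].
  exact: (@add_continuous 'cV[R]_p).
exact: (cvgZr_tmp (FF := nbhs_filter x) (@coord_continuous R p 1 j 0 x)).
Qed.

Lemma convex_conv (A : set 'cV[R]_p) :
  convex_set (A : set (convex_lmodType 'cV[R]_p)) <->
  forall x y (t : {i01 R}), A x -> A y -> A (t%:num *: x + (1 - t%:num) *: y).
Proof.
split=> h x y t.
  by move=> /mem_set Ax /mem_set Ay; apply: set_mem; exact: h.
by move=> /set_mem Ax /set_mem Ay; apply: mem_set; exact: h.
Qed.

Fact minkowski_sum_nonempty K L : minkowski_sum K L !=set0.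
Proof.
have [[k Kk] [l Ll]] := (body_nonempty K, body_nonempty L).
by exists (k + l); exists k => //; exists l.
Qed.

Fact minkowski_sum_compact K L : compact (minkowski_sum K L).
Proof.
have -> : minkowski_sum K L =
    (fun x : 'cV[R]_p * 'cV[R]_p => x.1 + x.2) @`
      ((K : set 'cV[R]_p) `*` (L : set 'cV[R]_p)).
  apply/seteqP; split => [_ [k Kk [l Ll <-]]|_ [[k l] [/= Kk Ll] <-]].
    by exists (k, l).
  by exists k => //; exists l.
apply: continuous_compact; last by apply: compact_setX; exact: body_compact.
by apply: continuous_subspaceT => x; exact: (@add_continuous 'cV[R]_p).
Qed.

Fact minkowski_sum_convex K L :
  convex_set (minkowski_sum K L : set (convex_lmodType 'cV[R]_p)).
Proof.
apply/convex_conv => _ _ t [k Kk [l Ll <-]] [k' Kk' [l' Ll' <-]].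
exists (t%:num *: k + (1 - t%:num) *: k').
  exact: (convex_conv K).1 (body_convex (c := K)) _ _ _ Kk Kk'.
exists (t%:num *: l + (1 - t%:num) *: l').
  exact: (convex_conv L).1 (body_convex (c := L)) _ _ _ Ll Ll'.
by rewrite !scalerDr addrACA.
Qed.

Fact matrix_image_nonempty M K : matrix_image M K !=set0.
Proof. by have [k Kk] := body_nonempty K; exists (M *m k); exists k. Qed.

Fact matrix_image_compact M K : compact (matrix_image M K).
Proof.
apply: continuous_compact; last exact: body_compact.
exact/continuous_subspaceT/continuous_mulmx_col.
Qed.

Fact matrix_image_convex M K :
  convex_set (matrix_image M K : set (convex_lmodType 'cV[R]_p)).
Proof.
apply/convex_conv => _ _ t [k Kk <-] [k' Kk' <-].
exists (t%:num *: k + (1 - t%:num) *: k').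
  exact: (convex_conv K).1 (body_convex (c := K)) _ _ _ Kk Kk'.
by rewrite mulmxDr -!scalemxAr.
Qed.

End closure_properties.

Definition body_add (R : realType) (p : nat) (K L : convex_body R p) :
    convex_body R p :=
  ConvexBody (minkowski_sum_nonempty K L) (@minkowski_sum_compact _ _ K L)
    (@minkowski_sum_convex _ _ K L).

Definition body_mul (R : realType) (p : nat) (M : 'M[R]_p)
    (K : convex_body R p) : convex_body R p :=
  ConvexBody (matrix_image_nonempty M K) (@matrix_image_compact _ _ M K)
    (@matrix_image_convex _ _ M K).

Definition random_set (d : measure_display) (Omega : measurableType d)
    (R : realType) (p : nat) (Gamma : Omega -> convex_body R p) : Prop :=
  forall K : convex_body R p,
    measurable [set w | (Gamma w : set 'cV[R]_p) `&` K !=set0].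

Fact random_set_affine (d : measure_display) (Omega : measurableType d)
    (R : realType) (p : nat) (Gamma : Omega -> convex_body R p) (M : 'M[R]_p)
    (L : convex_body R p) : M \in unitmx -> random_set Gamma ->
  random_set (fun w => body_add (body_mul M (Gamma w)) L).
Proof.
move=> Mu mG K.
have := mG (body_mul (invmx M) (body_add K (body_mul (- 1%:M) L))).
congr measurable; apply/seteqP; split=> w /=.
  move=> [x [Gx [y [k Kk [_ [l Ll <-] kly]] yx]]].
  exists k; split=> //; exists (M *m x); first by exists x.
  by exists l => //; rewrite -yx mulKVmx// -kly mulNmx mul1mx subrK.
move=> [k [[_ [x Gx <-] [l Ll xlk]] Kk]]; exists x; split=> //.
exists (M *m x); last by rewrite mulKmx.
exists k => //; exists (- l); first by exists l => //; rewrite mulNmx mul1mx.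
by rewrite -xlk addrK.
Qed.

Definition lower_halfspace (R : realType) (p : nat) (u : 'cV[R]_p) (t : R) :
  set (convex_body R p) := [set K | support_function K u <= t].

Definition upper_halfspace (R : realType) (p : nat) (u : 'cV[R]_p) (t : R) :
  set (convex_body R p) := [set K | support_function K u >= t].

Definition tukey_depth (d : measure_display) (Omega : measurableType d)
    (R : realType) (p : nat) (P : probability Omega R) (K : convex_body R p)
    (Gamma : Omega -> convex_body R p) : \bar R :=
  Order.min
    (ereal_inf [set P (Gamma @^-1` lower_halfspace ut.1 ut.2) |
       ut in [set ut : 'cV[R]_p * R |
         unit_sphere ut.1 /\ lower_halfspace ut.1 ut.2 K]])
    (ereal_inf [set P (Gamma @^-1` upper_halfspace ut.1 ut.2) |
       ut in [set ut : 'cV[R]_p * R |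
         unit_sphere ut.1 /\ upper_halfspace ut.1 ut.2 K]]).

(* Main.v *)
Require Import Defs.
From mathcomp Require Import all_boot all_order all_algebra.
From mathcomp Require Import all_classical all_reals all_analysis.
Import Order.TTheory GRing.Theory Num.Theory.
Import numFieldNormedType.Exports.

Local Open Scope classical_set_scope.
Local Open Scope ring_scope.

(** Taking preimages under the affine map [K |-> M K + L] permutes the halfspaces
of the space of convex bodies.  Indeed [s_(MK+L)(u) = s_K(M^T u) + s_L(u)], and support
functions are positively homogeneous, so writing [M^T u = c v] with [v] on the
sphere and [0 < c], the condition [s_(MK+L)(u) <= c t + s_L(u)] reads
[s_K(v) <= t], and likewise for [>=] (lemmas [support_function_affine],
[lower_halfspace_affine], [upper_halfspace_affine]).

Since [M^T] is invertible, every [u] on the sphere arises from some [v] and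
conversely ([unit_sphere_mulmx], applied to [M^T] and to its inverse), and for
a fixed such pair [t |-> c t + s_L(u)] is a bijection of the line.  Hence the
two infima that define the depth of [M K + L] run over exactly the same sets
of probabilities as those that define the depth of [K]
([halfspace_probabilities_affine]). *)

Section inner_product.
Set Implicit Arguments.
Unset Strict Implicit.
Context {R : realType} {p : nat}.
Implicit Types (x y u v : 'cV[R]_p) (A : 'M[R]_p).

Lemma dotDl x y u : dot (x + y) u = dot x u + dot y u.
Proof. by rewrite -big_split; apply: eq_bigr => i _; rewrite mxE mulrDl. Qed.

Lemma dotZl (a : R) x u : dot (a *: x) u = a * dot x u.
Proof. by rewrite mulr_sumr; apply: eq_bigr => i _; rewrite mxE mulrA. Qed.

Lemma dotC x y : dot x y = dot y x.
Proof. by apply: eq_bigr => i _; rewrite mulrC. Qed.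

Lemma dotZr (a : R) x u : dot x (a *: u) = a * dot x u.
Proof. by rewrite dotC dotZl dotC. Qed.

Lemma dot_mulmx A x u : dot (A *m x) u = dot x (A^T *m u).
Proof.
have dotE y z : dot y z = (y^T *m z) 0 0.
  by rewrite mxE; apply: eq_bigr => i _; rewrite mxE.
by rewrite !dotE trmx_mul mulmxA.
Qed.

Lemma dot_ge0 x : 0 <= dot x x.
Proof. by apply: sumr_ge0 => i _; rewrite -expr2 sqr_ge0. Qed.

Lemma dot_eq0 x : (dot x x == 0) = (x == 0).
Proof.
apply/eqP/eqP => [x0|->]; last by rewrite /dot big1// => i _; rewrite mxE mul0r.
apply/colP => i; rewrite mxE; apply/eqP; rewrite -sqrf_eq0 expr2.
by have /psumr_eq0P -> // := x0 => j _; rewrite -expr2 sqr_ge0.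
Qed.

Lemma continuous_dotl u : continuous (fun x : 'cV[R]_p => dot x u).
Proof.
apply: (@continuous_big R^o 'I_p) => [|i _ x].
  exact: (@add_continuous R^o).
exact: (cvgM (FF := nbhs_filter x) (@coord_continuous R p 1 i 0 x)
  (cvg_cst _)).
Qed.

(** Normalizing [A u], with [c] its Euclidean norm; it is nonzero because [A] is
injective. *)
Lemma unit_sphere_mulmx A u : A \in unitmx -> unit_sphere u ->
  exists v, exists2 c : R, unit_sphere v & 0 < c /\ A *m u = c *: v.
Proof.
move=> Au u1; set w := A *m u; set c := Num.sqrt (dot w w).
have c_gt0 : 0 < c.
  rewrite sqrtr_gt0 lt_neqAle dot_ge0 andbT eq_sym dot_eq0.
  apply/eqP => w0; have u0 : u = 0 by rewrite -(mulKmx Au u) -/w w0 mulmx0.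
  have /eqP : dot u u == 0 by rewrite dot_eq0 u0.
  move=> uu0; move: u1; rewrite /unit_sphere /= uu0 sqrtr0.
  by move/esym/eqP; rewrite oner_eq0.
exists (c^-1 *: w), c; last by rewrite scalerA mulfV ?gt_eqF// scale1r.
rewrite /unit_sphere /= dotZl dotZr mulrA -expr2 sqrtrM ?sqr_ge0//.
by rewrite sqrtr_sqr gtr0_norm ?invr_gt0// mulVf ?gt_eqF.
Qed.

End inner_product.

Section support_function.
Set Implicit Arguments.
Unset Strict Implicit.
Context {R : realType} {p : nat}.
Implicit Types (K L : convex_body R p) (u v k : 'cV[R]_p).

(** Being attained, the supremum is a maximum; the identities for support
functions below then follow by exhibiting maximizers. *)
Lemma support_function_max K u k : (K : set 'cV[R]_p) k ->
  (forall x, (K : set 'cV[R]_p) x -> dot x u <= dot k u) ->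
  support_function K u = dot k u.
Proof.
move=> Kk kmax; apply/eqP; rewrite eq_le; apply/andP; split.
  by apply: ge_sup => [|_ [x Kx <-]]; [exists (dot k u), k | exact: kmax].
apply: ub_le_sup; last by exists k.
by exists (dot k u) => _ [x Kx <-]; exact: kmax.
Qed.

Lemma support_function_attained K u : exists2 k, (K : set 'cV[R]_p) k &
  forall x, (K : set 'cV[R]_p) x -> dot x u <= dot k u.
Proof.
have [k Kk kmax] := @compact_EVT_max 'cV[R]_p R (fun x => dot x u) K
  (body_nonempty K) (@body_compact _ _ K)
  (continuous_subspaceT (@continuous_dotl R p u)).
by exists k => [|x Kx]; [exact: set_mem | exact/kmax/mem_set].
Qed.

(** The function [M x + y |-> dot (M x + y) u] is the sum of [c * dot x v] and
[dot y u], which are maximized independently over [K] and [L]. *)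
Lemma support_function_affine (M : 'M[R]_p) K L u v (c : R) :
  0 < c -> M^T *m u = c *: v ->
  support_function (body_add (body_mul M K) L) u =
  c * support_function K v + support_function L u.
Proof.
move=> c_gt0 Muv.
have [k Kk kmax] := support_function_attained K v.
have [l Ll lmax] := support_function_attained L u.
have dotE x y : dot (M *m x + y) u = c * dot x v + dot y u.
  by rewrite dotDl dot_mulmx Muv dotZr.
rewrite (@support_function_max K v k)// (@support_function_max L u l)//.
rewrite -dotE; apply: support_function_max.
  by exists (M *m k); [exists k | exists l].
move=> _ [_ [x Kx <-] [y Ly <-]].
by rewrite !dotE lerD ?ler_pM2l ?kmax ?lmax.
Qed.

Lemma lower_halfspace_affine (M : 'M[R]_p) K L u v (c t : R) :
  0 < c -> M^T *m u = c *: v ->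
  lower_halfspace u (c * t + support_function L u)
    (body_add (body_mul M K) L) = lower_halfspace v t K.
Proof.
move=> c_gt0 Muv; rewrite /lower_halfspace /=.
by rewrite (support_function_affine _ _ c_gt0 Muv) lerD2r ler_pM2l.
Qed.

Lemma upper_halfspace_affine (M : 'M[R]_p) K L u v (c t : R) :
  0 < c -> M^T *m u = c *: v ->
  upper_halfspace u (c * t + support_function L u)
    (body_add (body_mul M K) L) = upper_halfspace v t K.
Proof.
move=> c_gt0 Muv; rewrite /upper_halfspace /=.
by rewrite (support_function_affine _ _ c_gt0 Muv) lerD2r ler_pM2l.
Qed.

End support_function.

(** Abstracting the family [S] of halfspaces treats the lower and the upper
ones at once. *)
Lemma halfspace_probabilities_affine {R : realType} {p : nat}
    {d : measure_display} {Omega : measurableType d} (P : probability Omega R)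
    (Gamma : Omega -> convex_body R p) (M : 'M[R]_p) (K L : convex_body R p)
    (S : 'cV[R]_p -> R -> set (convex_body R p)) :
  M \in unitmx ->
  (forall K' u v (c t : R), 0 < c -> M^T *m u = c *: v ->
    S u (c * t + support_function L u) (body_add (body_mul M K') L) =
    S v t K') ->
  [set P ((fun w => body_add (body_mul M (Gamma w)) L) @^-1` S ut.1 ut.2) |
    ut in [set ut : 'cV[R]_p * R | unit_sphere ut.1 /\
      S ut.1 ut.2 (body_add (body_mul M K) L)]] =
  [set P (Gamma @^-1` S ut.1 ut.2) |
    ut in [set ut : 'cV[R]_p * R | unit_sphere ut.1 /\ S ut.1 ut.2 K]].
Proof.
move=> Mu Saff.
have MTu : M^T \in unitmx by rewrite unitmx_tr.
apply/seteqP; split=> [_ [[u t] /= [u1 SK] <-]|_ [[v t] /= [v1 SK] <-]].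
  have [v [c v1 [c_gt0 Muv]]] := unit_sphere_mulmx MTu u1.
  pose t' := c^-1 * (t - support_function L u).
  have tE : t = c * t' + support_function L u.
    by rewrite /t' mulVKf ?gt_eqF// subrK.
  exists (v, t') => /=; first by split=> //; rewrite -(Saff _ u v c) -?tE.
  congr (P _); apply/seteqP.
  by split=> w /=; rewrite tE (Saff _ u v c).
(* Normalizing the inverse image of [v] gives [M^-T v = c u], so the factor for
   the pair [(u, v)] is [c^-1]. *)
have MVu : invmx M^T \in unitmx by rewrite unitmx_inv.
have [u [c u1 [c_gt0 Mvu]]] := unit_sphere_mulmx MVu v1.
have cV_gt0 : 0 < c^-1 by rewrite invr_gt0.
have Muv : M^T *m u = c^-1 *: v.
  by rewrite -(mulKVmx MTu v) Mvu -scalemxAr scalerA mulVf ?gt_eqF// scale1r.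
exists (u, c^-1 * t + support_function L u) => /=.
  by split=> //; rewrite (Saff _ u v).
by congr (P _); apply/seteqP; split=> w /=; rewrite (Saff _ u v).
Qed.

Theorem proposition4p1 (R : realType) (p : nat) (p_ge1 : (1 <= p)%N)
    (d : measure_display) (Omega : measurableType d) (P : probability Omega R)
    (Gamma : Omega -> convex_body R p) (Gamma_random : random_set Gamma)
    (M : 'M[R]_p) (M_nonsingular : M \in unitmx) (K L : convex_body R p) :
  tukey_depth P (body_add (body_mul M K) L)
    (fun w => body_add (body_mul M (Gamma w)) L)
  = tukey_depth P K Gamma.
Proof.
rewrite /tukey_depth; congr (Order.min (ereal_inf _) (ereal_inf _)).
  apply: halfspace_probabilities_affine => // K' u v c t.
  exact: lower_halfspace_affine.
apply: halfspace_probabilities_affine => // K' u v c t.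
exact: upper_halfspace_affine.
Qed.
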